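(* Let $H$ be a finite-dimensional unimodular, strongly non-factorizable ribbon Hopf algebra over an algebraically closed field $\mathbb K$ (either $\mathbb C$ or of characteristic $p>2$). Then $H$ is neither chromatic non-degenerate nor chromatic compact.
   Context: Let $(H,R,v)$ be a finite-dimensional ribbon Hopf algebra, $M=R_{21}R=M'\otimes M''$ its monodromy matrix. A left integral is $\lambda\in H^*$ with $\lambda(h_{(2)})h_{(1)}=\lambda(h)1$ for all $h\in H$; a two-sided cointegral is $\Lambda\in H$ with $h\Lambda=\epsilon(h)\Lambda=\Lambda h$. $H$ is unimodular if it has a nonzero two-sided cointegral. A unimodular quasitriangular $(H,R)$ with nonzero left integral $\lambda$ is strongly non-factorizable if $\lambda(S(M'))M''=0$ (equivalently $\lambda(M'')S(M')=0$). Let $P_{\mathbb 1}$ be the projective cover of the trivial $H$-module, and let $\Lambda_{P_{\mathbb 1}},\Delta_0^{P_{\mathbb 1}}:P_{\mathbb 1}\to P_{\mathbb 1}$ be the maps given by the action of $\Lambda$ (nonzero two-sided cointegral) and of $\lambda(S(M'))M''$ respectively. $H$ is chromatic non-degenerate if $\Delta_0^{P_{\mathbb 1}}\neq0$, and chromatic compact if there is $\zeta\in\mathbb K^\times$ with $\Delta_0^{P_{\mathbb 1}}=\zeta\Lambda_{P_{\mathbb 1}}$. *)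

(* Defs.v *)
From HB Require Import structures.
From mathcomp Require Import all_boot all_order all_algebra all_field.
From mathcomp Require Import reals.
From mathcomp Require Import complex.

Set Implicit Arguments.
Unset Strict Implicit.
Unset Printing Implicit Defensive.

Import GRing.Theory.
Local Open Scope ring_scope.

(** [tens A B] is the space of matrices of coefficients of the elements of
  A (x) B on the family (a_i (x) b_j), for the bases (a_i) = [vbasis {:A}] and
  (b_j) = [vbasis {:B}].  Its elements are handled through pure tensors
  [a \ox b] and through the linear map [tlift f] induced by a bilinear map [f]
  (lemma [tliftE]). *)

Definition tens (K : fieldType) (A B : vectType K) : Type :=
  'M[K]_(\dim {:A}, \dim {:B}).

HB.instance Definition _ (K : fieldType) (A B : vectType K) :=
  Vector.copy (tens A B) 'M[K]_(\dim {:A}, \dim {:B}).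

Definition tprod (K : fieldType) (A B : vectType K) (a : A) (b : B) : tens A B :=
  \matrix_(i, j) (coord (vbasis {:A}) i a * coord (vbasis {:B}) j b).

Notation "a \ox b" := (tprod a b)
  (at level 40, left associativity, format "a  \ox  b") : ring_scope.

Definition tlift (K : fieldType) (A B : vectType K) (V : lmodType K)
    (f : A -> B -> V) (X : tens A B) : V :=
  \sum_i \sum_j (X : 'M_(_, _)) i j *: f (vbasis {:A})`_i (vbasis {:B})`_j.

Section TensorTheory.
Variables (K : fieldType) (A B : vectType K).
Implicit Types (a : A) (b : B) (X Y : tens A B).

Lemma tprodPl k a a' b : (k *: a + a') \ox b = k *: (a \ox b) + a' \ox b.
Proof. by apply/matrixP=> i j; rewrite !mxE linearP mulrDl mulrA. Qed.

Lemma tprodZl k a b : (k *: a) \ox b = k *: (a \ox b).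
Proof. by apply/matrixP=> i j; rewrite !mxE linearZ mulrA. Qed.

Fact tprod_linearr a : linear (@tprod K A B a).
Proof.
by move=> k b b'; apply/matrixP=> i j; rewrite !mxE linearP mulrDr mulrCA.
Qed.
HB.instance Definition _ a :=
  GRing.isLinear.Build K B (tens A B) _ (@tprod K A B a) (tprod_linearr a).

Lemma tens_sum X : X = tlift (@tprod K A B) X.
Proof.
transitivity (\sum_i \sum_j (X : 'M_(_, _)) i j *: (delta_mx i j : tens A B)).
  exact: matrix_sum_delta.
rewrite /tlift; apply: eq_bigr => i _; apply: eq_bigr => j _.
congr (_ *: _); apply/matrixP=> i' j'; rewrite !mxE (eq_sym i') (eq_sym j').
by rewrite !coord_free ?(basis_free (vbasisP _)) // -natrM mulnb.
Qed.

Section Lift.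
Variables (V : lmodType K) (f : A -> B -> V).

Fact tlift_linear : linear (tlift f).
Proof.
move=> k X Y; rewrite /tlift scaler_sumr -big_split /=.
apply: eq_bigr => i _; rewrite scaler_sumr -big_split /=.
by apply: eq_bigr => j _; rewrite !mxE scalerDl scalerA.
Qed.
HB.instance Definition _ :=
  GRing.isLinear.Build K (tens A B) V _ (tlift f) tlift_linear.

Lemma tliftE (fl : forall b, linear (f^~ b)) (fr : forall a, linear (f a)) a b :
  tlift f (a \ox b) = f a b.
Proof.
pose gl b : {linear A -> V} :=
  HB.pack (f^~ b) (GRing.isLinear.Build K A V _ (f^~ b) (fl b)).
pose gr a : {linear B -> V} :=
  HB.pack (f a) (GRing.isLinear.Build K B V _ (f a) (fr a)).
rewrite /tlift {2}(coord_vbasis (memvf a)).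
rewrite -[f _ b]/(gl b _) linear_sum; apply: eq_bigr => i _.
rewrite linearZ /= {2}(coord_vbasis (memvf b)).
rewrite -[f _ (\sum__ _)]/(gr _ _) linear_sum scaler_sumr.
by apply: eq_bigr => j _; rewrite linearZ mxE scalerA.
Qed.
End Lift.

Lemma tens_ind (P : tens A B -> Prop) : P 0 ->
  (forall X Y, P X -> P Y -> P (X + Y)) -> (forall a b, P (a \ox b)) ->
  forall X, P X.
Proof.
move=> P0 PD Pt X; rewrite (tens_sum X) /tlift.
elim/big_ind: _ => // i _; elim/big_ind: _ => // j _.
by rewrite -tprodZl; apply: Pt.
Qed.

End TensorTheory.

Section TensorAlgebra.
Variables (K : fieldType) (A B : falgType K).
Implicit Types (a c : A) (b d : B) (X Y Z : tens A B).

Definition tens_mul X Y : tens A B :=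
  tlift (fun a b => tlift (fun c d => (a * c) \ox (b * d)) Y) X.

Fact tens_mul_linearl Y : linear (tens_mul^~ Y).
Proof. by move=> k X X'; rewrite /tens_mul linearP. Qed.

Fact tens_mul_linearr X : linear (tens_mul X).
Proof.
move=> k Y Y'; rewrite /tens_mul {1 3 5}/tlift scaler_sumr -big_split /=.
apply: eq_bigr => i _; rewrite scaler_sumr -big_split /=.
by apply: eq_bigr => j _; rewrite linearP scalerDr !scalerA mulrC.
Qed.

Lemma tens_mulE a b c d : tens_mul (a \ox b) (c \ox d) = (a * c) \ox (b * d).
Proof.
have E a' b' : tlift (fun c d => (a' * c) \ox (b' * d)) (c \ox d)
             = (a' * c) \ox (b' * d).
  apply: (tliftE (f := fun c d => (a' * c) \ox (b' * d))).
    by move=> d' k x y; rewrite mulrDr -scalerAr; apply: tprodPl.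
  by move=> c' k x y; rewrite mulrDr -scalerAr linearP.
rewrite /tens_mul tliftE ?E //.
  move=> b' k x y; rewrite {1 2}/tlift scaler_sumr -big_split /=.
  apply: eq_bigr => i _; rewrite scaler_sumr -big_split /=.
  apply: eq_bigr => j _; rewrite mulrDl -scalerAl.
  by rewrite tprodPl scalerDr !scalerA mulrC.
move=> a' k x y; rewrite {1 2}/tlift scaler_sumr -big_split /=.
apply: eq_bigr => i _; rewrite scaler_sumr -big_split /=.
apply: eq_bigr => j _; rewrite mulrDl -scalerAl.
by rewrite linearP scalerDr !scalerA mulrC.
Qed.

Let tmul0l Y : tens_mul 0 Y = 0.
Proof. by have := tens_mul_linearl Y (-1) 0 0; rewrite scaler0 addr0 scaleN1r addNr. Qed.
Let tmul0r X : tens_mul X 0 = 0.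
Proof. by have := tens_mul_linearr X (-1) 0 0; rewrite scaler0 addr0 scaleN1r addNr. Qed.
Fact tens_mulDl : left_distributive tens_mul +%R.
Proof. by move=> X Y Z; have := tens_mul_linearl Z 1 X Y; rewrite !scale1r. Qed.
Fact tens_mulDr : right_distributive tens_mul +%R.
Proof. by move=> X Y Z; have := tens_mul_linearr X 1 Y Z; rewrite !scale1r. Qed.

Fact tens_mulA : associative tens_mul.
Proof.
elim/tens_ind=> [|X X' IH IH'|a b] Y Z; first by rewrite !tmul0l.
  by rewrite !tens_mulDl IH IH'.
elim/tens_ind: Y => [|Y Y' IH IH'|c d]; first by rewrite !(tmul0l, tmul0r).
  by rewrite !(tens_mulDl, tens_mulDr) IH IH'.
elim/tens_ind: Z => [|Z Z' IH IH'|e f]; first by rewrite !tmul0r.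
  by rewrite !tens_mulDr IH IH'.
by rewrite !tens_mulE !mulrA.
Qed.

Fact tens_mul1l : left_id (1 \ox 1) tens_mul.
Proof.
elim/tens_ind=> [|X X' IH IH'|a b]; first by rewrite tmul0r.
  by rewrite tens_mulDr IH IH'.
by rewrite tens_mulE !mul1r.
Qed.

Fact tens_mul1r : right_id (1 \ox 1) tens_mul.
Proof.
elim/tens_ind=> [|X X' IH IH'|a b]; first by rewrite tmul0l.
  by rewrite tens_mulDl IH IH'.
by rewrite tens_mulE !mulr1.
Qed.

Fact tens_1_neq0 : (1 : A) \ox (1 : B) != 0.
Proof.
have nz (C : falgType K) : exists i, coord (vbasis {:C}) i 1 != 0.
  apply/existsP; rewrite -negb_forall; apply/negP=> /forallP z.
  have /eqP[] := oner_neq0 C; rewrite (coord_vbasis (memvf 1)) big1 // => i _.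
  by rewrite (eqP (z i)) scale0r.
have [[i iP] [j jP]] := (nz A, nz B).
apply: contraNneq (mulf_neq0 iP jP) => /(congr1 (fun M : 'M_(_, _) => M i j)).
by rewrite !mxE => ->.
Qed.

HB.instance Definition _ := GRing.Zmodule_isNzRing.Build (tens A B)
  tens_mulA tens_mul1l tens_mul1r tens_mulDl tens_mulDr tens_1_neq0.

Fact tens_scalerAl (k : K) X Y : k *: (X * Y) = (k *: X) * Y.
Proof. by have := tens_mul_linearl Y k X 0; rewrite !addr0 tmul0l addr0. Qed.
HB.instance Definition _ :=
  GRing.Lmodule_isLalgebra.Build K (tens A B) tens_scalerAl.

Fact tens_scalerAr (k : K) X Y : k *: (X * Y) = X * (k *: Y).
Proof. by have := tens_mul_linearr X k Y 0; rewrite !addr0 tmul0r addr0. Qed.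
HB.instance Definition _ :=
  GRing.Lalgebra_isAlgebra.Build K (tens A B) tens_scalerAr.

HB.instance Definition _ := Algebra_isFalgebra.Build K (tens A B).

Lemma tprodM a b c d : (a \ox b) * (c \ox d) = (a * c) \ox (b * d) :> tens A B.
Proof. exact: tens_mulE. Qed.

Lemma tprod1 : 1 \ox 1 = 1 :> tens A B.
Proof. by []. Qed.

End TensorAlgebra.

Section TensorMaps.
Variable K : fieldType.
Implicit Types A B C D : vectType K.

Definition tmap A B C D (f : A -> C) (g : B -> D) : tens A B -> tens C D :=
  tlift (fun a b => f a \ox g b).

Definition tflip A B : tens A B -> tens B A := tlift (fun a b => b \ox a).

Definition tassoc A B C : tens A (tens B C) -> tens (tens A B) C :=
  tlift (fun a => tlift (fun b c => a \ox b \ox c)).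

End TensorMaps.

Record hopfAlgebra (K : fieldType) := HopfAlgebra {
  hopf_alg :> falgType K;
  comul : {lrmorphism hopf_alg -> tens hopf_alg hopf_alg};
  counit : {lrmorphism hopf_alg -> K | *%R};
  antipode : {linear hopf_alg -> hopf_alg};
  comulA : forall h,
    tmap comul idfun (comul h) = tassoc (tmap idfun comul (comul h));
  counitl : forall h, tlift (fun a b => counit a *: b) (comul h) = h;
  counitr : forall h, tlift (fun a b => counit b *: a) (comul h) = h;
  antipodel : forall h,
    tlift (fun a b => antipode a * b) (comul h) = (counit h)%:A;
  antipoder : forall h,
    tlift (fun a b => a * antipode b) (comul h) = (counit h)%:A
}.

Arguments comul {K _}.
Arguments counit {K _}.
Arguments antipode {K _}.

Section Legs.
Variables (K : fieldType) (H : falgType K) (R : tens H H).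
Definition leg12 : tens (tens H H) H := tlift (fun a b => a \ox b \ox 1) R.
Definition leg13 : tens (tens H H) H := tlift (fun a b => a \ox 1 \ox b) R.
Definition leg23 : tens (tens H H) H := tlift (fun a b => 1 \ox a \ox b) R.
End Legs.

Record quasitriangularHopfAlgebra (K : fieldType) := QuasitriangularHopfAlgebra {
  quasi_hopf :> hopfAlgebra K;
  Rmatrix : tens quasi_hopf quasi_hopf;
  Rmatrix_unit : Rmatrix \is a GRing.unit;
  Rmatrix_comul : forall h : quasi_hopf,
    Rmatrix * comul h = tflip (comul h) * Rmatrix;
  Rmatrix_hexl : tmap comul idfun Rmatrix = leg13 Rmatrix * leg23 Rmatrix;
  Rmatrix_hexr :
    tassoc (tmap idfun comul Rmatrix) = leg13 Rmatrix * leg12 Rmatrix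
}.

Arguments Rmatrix {K}.

Section QuasitriangularTheory.
Variables (K : fieldType) (H : quasitriangularHopfAlgebra K).

Definition monodromy : tens H H := tflip (Rmatrix H) * Rmatrix H.

(* u = S(R'') R' *)
Definition drinfeld : H := tlift (fun a b => antipode b * a) (Rmatrix H).

End QuasitriangularTheory.

Arguments monodromy {K}.
Arguments drinfeld {K}.

(* Conventions: the ribbon element satisfies v^2 = u S(u) and
   Delta(v) = (R_21 R)^-1 (v (x) v), as in Reshetikhin-Turaev and Kassel. *)
Record ribbonHopfAlgebra (K : fieldType) := RibbonHopfAlgebra {
  ribbon_quasi :> quasitriangularHopfAlgebra K;
  ribbon : ribbon_quasi;
  ribbon_unit : ribbon \is a GRing.unit;
  ribbon_central : forall h : ribbon_quasi, ribbon * h = h * ribbon;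
  ribbon_sqr :
    ribbon ^+ 2 = drinfeld ribbon_quasi * antipode (drinfeld ribbon_quasi);
  ribbon_comul :
    comul ribbon = (monodromy ribbon_quasi)^-1 * (ribbon \ox ribbon);
  ribbon_counit : counit ribbon = 1;
  ribbon_antipode : antipode ribbon = ribbon
}.

Section Integrals.
Variables (K : fieldType) (H : hopfAlgebra K).

(* lambda(h_(2)) h_(1) = lambda(h) 1 *)
Definition left_integral (lambda : {scalar H}) : Prop :=
  forall h : H, tlift (fun a b => lambda b *: a) (comul h) = (lambda h)%:A.

Definition nonzero_left_integral (lambda : {scalar H}) : Prop :=
  left_integral lambda /\ exists h, lambda h != 0.

Definition two_sided_cointegral (Lambda : H) : Prop :=
  forall h : H,
    h * Lambda = counit h *: Lambda /\ Lambda * h = counit h *: Lambda.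

Definition nonzero_two_sided_cointegral (Lambda : H) : Prop :=
  two_sided_cointegral Lambda /\ Lambda != 0.

Definition unimodular : Prop :=
  exists Lambda : H, nonzero_two_sided_cointegral Lambda.

End Integrals.

Arguments unimodular {K}.

(* lambda(S(M')) M'' *)
Definition monodromy_integral (K : fieldType) (H : quasitriangularHopfAlgebra K)
    (lambda : {scalar H}) : H :=
  tlift (fun a b => lambda (antipode a) *: b) (monodromy H).

Definition strongly_non_factorizable (K : fieldType)
    (H : quasitriangularHopfAlgebra K) (lambda : {scalar H}) : Prop :=
  [/\ unimodular H, nonzero_left_integral lambda & monodromy_integral lambda = 0].

(** An [lmodType H] is a left H-module; a map between two of them is H-linear
  when it is a [{linear _ -> _}]. *)

Definition trivial_module (K : fieldType) (H : hopfAlgebra K) : Type := K.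

Section TrivialModule.
Variables (K : fieldType) (H : hopfAlgebra K).

HB.instance Definition _ := GRing.Zmodule.copy (trivial_module H) K.

Definition trivial_scale (h : H) (k : trivial_module H) : trivial_module H :=
  counit h * (k : K).

Fact trivial_scaleA (g h : H) k :
  trivial_scale g (trivial_scale h k) = trivial_scale (g * h) k.
Proof. by rewrite /trivial_scale rmorphM mulrA. Qed.

Fact trivial_scale1 : left_id 1 trivial_scale.
Proof. by move=> k; rewrite /trivial_scale rmorph1 mul1r. Qed.

Fact trivial_scaleDr : right_distributive trivial_scale +%R.
Proof. by move=> h k l; apply: mulrDr. Qed.

Fact trivial_scaleDl k : {morph trivial_scale^~ k : g h / g + h}.
Proof. by move=> g h; rewrite /trivial_scale rmorphD; apply: mulrDl. Qed.

HB.instance Definition _ := GRing.Zmodule_isLmodule.Build H (trivial_module H)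
  trivial_scaleA trivial_scale1 trivial_scaleDr trivial_scaleDl.

End TrivialModule.

Definition surjective (T U : Type) (f : T -> U) : Prop :=
  forall y, exists x, f x = y.

Section ProjectiveCover.
Variable R : nzRingType.

Definition projective (P : lmodType R) : Prop :=
  forall (M N : lmodType R) (g : {linear M -> N}) (f : {linear P -> N}),
    surjective g -> exists h : {linear P -> M}, forall p, g (h p) = f p.

(* An epimorphism pi is essential (i.e. has a superfluous kernel) if any g such
   that pi \o g is an epimorphism is itself an epimorphism. *)
Definition essential_epi (P V : lmodType R) (pi : {linear P -> V}) : Prop :=
  surjective pi /\
  forall (N : lmodType R) (g : {linear N -> P}),
    surjective (pi \o g) -> surjective g.

Definition projective_cover (P V : lmodType R) : Prop :=
  projective P /\ exists pi : {linear P -> V}, essential_epi pi.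

End ProjectiveCover.

Section Chromatic.
Variables (K : fieldType) (H : quasitriangularHopfAlgebra K).
Variables (lambda : {scalar H}) (P : lmodType H).

Definition Lambda_map (Lambda : H) (p : P) : P := Lambda *: p.

Definition Delta0_map (p : P) : P := monodromy_integral lambda *: p.

Definition chromatic_nondegenerate : Prop := exists p, Delta0_map p != 0.

Definition chromatic_compact (Lambda : H) : Prop :=
  exists2 zeta : K, zeta != 0 &
    forall p, Delta0_map p = (zeta%:A : H) *: Lambda_map Lambda p.

End Chromatic.

(* K is isomorphic to the field of complex numbers; a realType is a model of the
   (unique up to isomorphism) complete archimedean ordered field. *)
Definition is_complex_field (K : fieldType) : Prop :=
  exists (R : realType) (f : {rmorphism K -> R[i]}), bijective f.

(* Main.v *)
Require Import Defs.
From HB Require Import structures.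
From mathcomp Require Import all_boot all_order all_algebra all_field.

Import GRing.Theory.
Local Open Scope ring_scope.

(** Strong non-factorizability says that [monodromy_integral lambda] is 0, so it acts by zero on
    every module, which excludes non-degeneracy. Compactness would then force [Lambda], up to an
    invertible scalar, to act by zero on [P1]. By [cointegral_projective_neq0] this is impossible:
    the counit maps the regular module onto the trivial one, and projectivity lifts [pi] through
    it. *)

Definition counit_map (K : fieldType) (H : hopfAlgebra K) (h : (H : nzRingType)^o) :
  trivial_module H := counit h.

Fact counit_map_linear (K : fieldType) (H : hopfAlgebra K) :
  linear (@counit_map K H).
Proof. by move=> a x y; rewrite /counit_map rmorphD rmorphM. Qed.

HB.instance Definition _ (K : fieldType) (H : hopfAlgebra K) :=
  GRing.isLinear.Build H (H : nzRingType)^o (trivial_module H) _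
    (@counit_map K H) (@counit_map_linear K H).

Lemma counit_map_surj (K : fieldType) (H : hopfAlgebra K) :
  surjective (@counit_map K H).
Proof.
move=> k; exists ((k : K)%:A : H).
by rewrite /counit_map linearZ rmorph1; apply: mulr1.
Qed.

(* Lifting pi through the counit gives s : P -> H with counit (s p) = pi p, so
   that s (Lambda p) = Lambda (s p) = pi p Lambda. *)
Lemma cointegral_projective_neq0 (K : fieldType) (H : hopfAlgebra K)
    (Lambda : H) (P : lmodType H) (pi : {linear P -> trivial_module H}) :
  nonzero_two_sided_cointegral Lambda -> projective P -> surjective pi ->
  exists p : P, Lambda *: p != 0.
Proof.
move=> [Lam Lam0] projP pi_surj.
have [s sE] := projP _ _ (@counit_map K H) pi (@counit_map_surj K H).
have [p pi_p] := pi_surj (1 : K).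
exists p; apply: contraNneq Lam0 => Lp0.
have := linearZ_LR s Lambda p; rewrite Lp0 linear0 => /esym LsP.
(* The regular module acts by left multiplication, so this is the right-hand half of the cointegral
   identity. *)
have LsE : Lambda * s p = counit (s p) *: Lambda := (Lam (s p)).2.
have sp1 : counit (s p : H) = 1 by rewrite -[LHS]/(@counit_map K H (s p)) sE.
by rewrite -[Lambda]scale1r -sp1 -LsE; apply/eqP.
Qed.

Theorem proposition7p4 (K : closedFieldType)
    (hK : is_complex_field K \/ exists2 p : nat, p \in [pchar K] & (2 < p)%N)
    (H : ribbonHopfAlgebra K) (H_unimodular : unimodular H)
    (lambda : {scalar H}) (h_lambda : nonzero_left_integral lambda)
    (H_snf : strongly_non_factorizable lambda)
    (Lambda : H) (h_Lambda : nonzero_two_sided_cointegral Lambda)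
    (P1 : lmodType H) (h_P1 : projective_cover P1 (trivial_module H)) :
  ~ chromatic_nondegenerate lambda P1 /\
  ~ chromatic_compact lambda P1 Lambda.
Proof.
have [_ _ M0] := H_snf; have [projP [pi [pi_surj _]]] := h_P1.
split=> [[p]|[zeta zeta0 cc]]; first by rewrite /Delta0_map M0 scale0r eqxx.
have [p /eqP[]] :=
  @cointegral_projective_neq0 _ _ _ _ pi h_Lambda projP pi_surj.
have := cc p; rewrite /Delta0_map /Lambda_map M0 scale0r.
(* [P1] is a module over [H] only, so [zeta] acts through [zeta%:A] and must be inverted inside
   [H]. *)
have zetaV : (zeta^-1)%:A * zeta%:A = 1 :> H.
  by rewrite mulr_algl [LHS]scalerA mulVf // scale1r.
move/(congr1 (GRing.scale ((zeta^-1)%:A : H))).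
by rewrite scaler0 (scalerA ((zeta^-1)%:A : H)) zetaV scale1r.
Qed.
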